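(* Let $N\ge 2$, let $F(\cdot,t):\mathbb{R}^n\times\mathbb{R}^n\rightrightarrows\mathbb{R}^n$ ($t=0,\dots,N-2$) be convex set-valued mappings, let $Q_0,Q_1\subseteq\mathbb{R}^n$ be nonempty convex sets, and let $\varphi:\mathbb{R}^{2n}\to\mathbb{R}$ be a continuous convex function. Consider the problem $(P_D)$: minimize $\varphi(x_{N-1},x_N)$ over sequences $\{x_t\}_{t=0}^N\subset\mathbb{R}^n$ subject to $x_{t+2}\in F(x_t,x_{t+1},t)$, $t=0,\dots,N-2$, and $x_0\in Q_0$, $x_1\in Q_1$. Let $\{\tilde x_t\}_{t=0}^N$ be an optimal trajectory of $(P_D)$. Then there exist vectors $x_t^*$, $x_N^*$, $\mu_t^*\in\mathbb{R}^n$, $t=0,\dots,N-1$, and a number $\lambda\in\{0,1\}$, not all simultaneously zero, such that (i) $(x_t^*-\mu_t^*,\ \mu_{t+1}^* )\in F^*\big(x_{t+2}^*;(\tilde x_t,\tilde x_{t+1},\tilde x_{t+2}),t\big)$, $t=0,1,\dots,N-2$; (ii) $\mu_0^*-x_0^*\in K_{Q_0}^*(\tilde x_0)$ and $-x_1^*\in K_{Q_1}^*(\tilde x_1)$; (iii) $(\mu_{N-1}^*-x_{N-1}^*,\ -x_N^* )\in\lambda\,\partial_{(x,y)}\varphi(\tilde x_{N-1},\tilde x_N)$. Moreover, if the nondegeneracy condition is satisfied, then $\lambda=1$, and these conditions (i)-(iii) (with $\lambda=1$) are sufficient for optimality of the feasible trajectory $\{\tilde x_t\}_{t=0}^N$.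
   Context: A set-valued mapping $G:\mathbb{R}^{2n}\rightrightarrows\mathbb{R}^n$ is convex if $\mathrm{gph}\,G=\{(x,y,z): z\in G(x,y)\}$ is a convex subset of $\mathbb{R}^{3n}$. Tangent cone: for a convex set $A$ and $w_0\in A$, $K_A(w_0)$ is the convex cone of tangent directions, i.e. of vectors $\bar w$ for which there is a function $\eta$ with $w_0+\lambda\bar w+\eta(\lambda)\in A$ for all sufficiently small $\lambda>0$ and $\lambda^{-1}\eta(\lambda)\to0$ as $\lambda\downarrow0$. $K_A^*(w_0)=\{w^*:\langle \bar w,w^*\rangle\ge0\ \ \forall\,\bar w\in K_A(w_0)\}$ is the dual cone (for convex $A$ this equals $\{w^*:\langle w-w_0,w^*\rangle\ge 0\ \forall w\in A\}$). Locally adjoint mapping (LAM): $G^*(z^*;(x,y,z))=\{(x^*,y^* ):(x^*,y^*,-z^* )\in K^*_{\mathrm{gph}\,G}(x,y,z)\}$ for $(x,y,z)\in\mathrm{gph}\,G$. $F^*(\cdot\,;\cdot,t)$ denotes the LAM of $F(\cdot,t)$. $\partial_{(x,y)}\varphi$ is the subdifferential of convex analysis. A feasible trajectory is a sequence $\{x_t\}_{t=0}^N$ satisfying the constraints of $(P_D)$. Nondegeneracy condition: there are points $x_t\in\mathbb{R}^n$, $t=0,\dots,N$, such that one of the following holds: (1) $(x_t,x_{t+1},x_{t+2})\in\mathrm{ri}\,\mathrm{gph}\,F(\cdot,t)$, $t=0,\dots,N-2$, $x_0\in\mathrm{ri}\,Q_0$, $x_1\in\mathrm{ri}\,Q_1$,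 $(x_{N-1},x_N)\in\mathrm{ri}\,\mathrm{dom}\,\varphi$; (2) $(x_t,x_{t+1},x_{t+2})\in\mathrm{int}\,\mathrm{gph}\,F(\cdot,t)$, $t=0,\dots,N-2$, $x_0\in\mathrm{int}\,Q_0$, $x_1\in\mathrm{int}\,Q_1$ (with the possible exception of one fixed $t$, for which only membership in the set itself is required), and $\varphi$ is continuous at $(x_{N-1},x_N)$. Here $\mathrm{ri}$ denotes relative interior, $\mathrm{int}$ interior and $\mathrm{dom}\,\varphi=\{\varphi<+\infty\}$. *)

(* Defs.v *)
From HB Require Import structures.
From mathcomp Require Import all_boot all_order all_algebra.
From mathcomp Require Import all_classical all_reals all_analysis.

Set Implicit Arguments.
Unset Strict Implicit.
Unset Printing Implicit Defensive.

Import Order.TTheory GRing.Theory Num.Theory.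
Import numFieldNormedType.Exports.

Local Open Scope classical_set_scope.
Local Open Scope ring_scope.

Section ConvexAnalysis.
Context {R : realType} {m : nat}.
Implicit Types (A : set 'rV[R]_m) (w : 'rV[R]_m) (f : 'rV[R]_m -> R).

Definition dot (u v : 'rV[R]_m) : R := \sum_(i < m) u 0 i * v 0 i.

Definition tangent_cone A w0 : set 'rV[R]_m :=
  [set w | exists eta : R -> 'rV[R]_m,
     (\forall l \near 0^'+, A (w0 + l *: w + eta l)) /\
     l^-1 *: eta l @[l --> 0^'+] --> (0 : 'rV[R]_m)].

Definition dual_cone A w0 : set 'rV[R]_m :=
  [set ws | forall w, tangent_cone A w0 w -> 0 <= dot w ws].

Definition subdifferential f w0 : set 'rV[R]_m :=
  [set g | forall w, f w0 + dot (w - w0) g <= f w].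

Definition affine_hull A : set 'rV[R]_m :=
  [set w | exists (k : nat) (p : 'I_k -> 'rV[R]_m) (c : 'I_k -> R),
     [/\ forall i, A (p i), \sum_(i < k) c i = 1
       & w = \sum_(i < k) c i *: p i]].

Definition relative_interior A : set 'rV[R]_m :=
  [set w | A w /\ \forall v \near w, affine_hull A v -> A v].

Definition effective_domain f : set 'rV[R]_m :=
  [set w | ((f w)%:E < +oo)%E].

End ConvexAnalysis.

Section SetValued.
Context {R : realType} {n : nat}.
Implicit Types (G : 'rV[R]_n -> 'rV[R]_n -> set 'rV[R]_n) (x y z : 'rV[R]_n).

Definition vec2 x y : 'rV[R]_(n + n) := row_mx x y.
Definition vec3 x y z : 'rV[R]_(n + n + n) := row_mx (row_mx x y) z.

Definition gph G : set 'rV[R]_(n + n + n) :=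
  [set w | exists x y z, G x y z /\ w = vec3 x y z].

(* [LAM G zs x y z] is G^*(zs; (x, y, z)); it is meaningful only when
   (x, y, z) lies in gph G. *)
Definition LAM G (zs x y z : 'rV[R]_n) : set ('rV[R]_n * 'rV[R]_n) :=
  [set p | dual_cone (gph G) (vec3 x y z) (vec3 p.1 p.2 (- zs))].

End SetValued.

(* Finite sequences are represented by functions on nat: of a trajectory
   x_0, ..., x_N only the entries of index <= N are ever used, and of the
   family F only the mappings F t = F(., t) with t + 2 <= N. *)
Section Problem.
Context {R : realType} {n : nat} (N : nat).
Variables (F : nat -> 'rV[R]_n -> 'rV[R]_n -> set 'rV[R]_n)
          (Q0 Q1 : set 'rV[R]_n) (phi : 'rV[R]_(n + n) -> R).
Implicit Types (x xs mus : nat -> 'rV[R]_n).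

Definition feasible x : Prop :=
  [/\ forall t, (t.+2 <= N)%N -> F t (x t) (x t.+1) (x t.+2),
      Q0 (x 0%N) & Q1 (x 1%N)].

Definition cost x : R := phi (vec2 (x N.-1) (x N)).

Definition optimal x : Prop :=
  feasible x /\ forall y, feasible y -> cost x <= cost y.

Definition optimality_conditions x xs mus (lambda : R) : Prop :=
  [/\ forall t, (t.+2 <= N)%N ->
        LAM (F t) (xs t.+2) (x t) (x t.+1) (x t.+2)
            (xs t - mus t, mus t.+1),
      dual_cone Q0 (x 0%N) (mus 0%N - xs 0%N),
      dual_cone Q1 (x 1%N) (- xs 1%N)
    & [set lambda *: g | g in subdifferential phi (vec2 (x N.-1) (x N))]
        (vec2 (mus N.-1 - xs N.-1) (- xs N))].

Definition nondegeneracy_ri x : Prop :=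
  [/\ forall t, (t.+2 <= N)%N ->
        relative_interior (gph (F t)) (vec3 (x t) (x t.+1) (x t.+2)),
      relative_interior Q0 (x 0%N), relative_interior Q1 (x 1%N)
    & relative_interior (effective_domain phi) (vec2 (x N.-1) (x N))].

(* The exception allowed in the interiority condition concerns at most one of
   the sets gph (F t), Q0, Q1; taking t0 >= N - 1 means no exception. *)
Definition nondegeneracy_int x : Prop :=
  let int_gph t := (gph (F t))° (vec3 (x t) (x t.+1) (x t.+2)) in
  [/\ feasible x,
      [\/ [/\ exists t0, forall t, (t.+2 <= N)%N -> t <> t0 -> int_gph t,
              Q0° (x 0%N) & Q1° (x 1%N)],
          (forall t, (t.+2 <= N)%N -> int_gph t) /\ Q1° (x 1%N)
        | (forall t, (t.+2 <= N)%N -> int_gph t) /\ Q0° (x 0%N)]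
    & {for vec2 (x N.-1) (x N), continuous phi}].

Definition nondegeneracy_condition : Prop :=
  exists x, nondegeneracy_ri x \/ nondegeneracy_int x.

End Problem.

(* Main.v *)
Require Import Defs.
From HB Require Import structures.
From mathcomp Require Import all_boot all_order all_algebra.
From mathcomp Require Import all_classical all_reals all_analysis.
From mathcomp Require Import ring lra.

Set Implicit Arguments.
Unset Strict Implicit.
Unset Printing Implicit Defensive.

Import Order.TTheory GRing.Theory Num.Theory.
Import numFieldNormedType.Exports passmx.

Local Open Scope classical_set_scope.
Local Open Scope ring_scope.

(** Necessity. The constraints are linear in the trajectory: the windows
    (x_t, x_t+1, x_t+2) must lie in the graphs and x_0, x_1 in Q_0, Q_1. In
    other words a linear map A (here [windows]) sends the trajectory into a
    convex set C of a finite-dimensional product space. Optimality of a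
    trajectory x says that the convex set of all pairs
    (c - A w, phi(w) - phi(x) + r), with c in C, w any trajectory and r > 0,
    misses the origin. Separating it from the origin yields a linear form u and
    a number lambda >= 0 such that u is minimal on C at A x, and
    lambda phi - u o A is minimal at x; this is [fritz_john], and scaling makes
    lambda equal to 0 or 1.

    It remains to read u componentwise. Since C is a product, minimality of u on
    C splits into one dual cone condition per factor ([pairing_minP]). Since phi
    depends on the last two states only, u o A vanishes on the trajectories
    which end with two zeros. The equations that this imposes on the blocks of
    u say precisely that u is given by two sequences x*_t and mu*_t in the form
    of (i) and (ii) ([adjoint_representation]), and what is left of u o A, the
    pairing of the last two states with (mu*_N-1 - x*_N-1, - x*_N), must be in
    lambda times the subdifferential of phi. This last computation is the
    summation by parts [pairing_windows].

    Multipliers. The separation is proper: the separating form is not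
    identically zero on the separated set. When lambda = 0 the form u o A
    vanishes, so properness means that u is not identically zero on C. In
    particular the multipliers are not all zero. On the other hand u is
    nonnegative on C and vanishes at the point A w of the nondegeneracy
    condition. There each component of u is constant on its factor when the
    point is relatively interior, and is zero when the point is interior; one
    remaining component is then zero because u o A = 0 and A maps onto each
    single factor. Hence u vanishes on C ([nondegenerate_pairing_eq0]), and
    lambda = 1.

    Sufficiency. Conditions (i) and (ii) say that the form u attached to the
    multipliers is minimal on C at A x. By summation by parts its values on
    trajectories only involve the last two states, and (iii) with lambda = 1
    bounds the increase of phi below by the increase of u. *)

(** * Convexity and the scalar product *)

Lemma convex_setP (R : realType) (E : lmodType R) (A : set E) :
  convex_set A <-> forall x y t, 0 <= t -> t <= 1 -> A x -> A y ->
                     A (t *: x + (1 - t) *: y).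
Proof.
split=> cA x y t.
  move=> t0 t1 Ax Ay; have := cA x y (Itv01 t0 t1).
  by rewrite !inE => /(_ Ax Ay).
rewrite !inE => Ax Ay; exact: cA.
Qed.

Lemma convex_functionP (R : realType) (E : lmodType R) (f : E -> R) :
  convex_function setT f <-> forall x y t, 0 <= t -> t <= 1 ->
    f (t *: x + (1 - t) *: y) <= t * f x + (1 - t) * f y.
Proof.
split=> [cf x y t t0 t1|cf t x y _ _]; last exact: cf.
by apply: (cf (Itv01 t0 t1)); rewrite inE.
Qed.

Section Dot.
Context {R : realType} {m : nat}.
Implicit Types u v w : 'rV[R]_m.

Lemma dotC u v : dot u v = dot v u.
Proof. by apply: eq_bigr => i _; rewrite mulrC. Qed.

Lemma dotDr u v w : dot u (v + w) = dot u v + dot u w.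
Proof. by rewrite -big_split; apply: eq_bigr => i _; rewrite mxE mulrDr. Qed.

Lemma dotZr (a : R) u v : dot u (a *: v) = a * dot u v.
Proof.
by rewrite /dot mulr_sumr; apply: eq_bigr => i _; rewrite mxE mulrCA.
Qed.

Lemma dotDl u v w : dot (u + v) w = dot u w + dot v w.
Proof. by rewrite dotC dotDr !(dotC w). Qed.

Lemma dotZl (a : R) u v : dot (a *: u) v = a * dot u v.
Proof. by rewrite dotC dotZr dotC. Qed.

Lemma dotNr u v : dot u (- v) = - dot u v.
Proof. by rewrite -scaleN1r dotZr mulN1r. Qed.

Lemma dotNl u v : dot (- u) v = - dot u v.
Proof. by rewrite dotC dotNr dotC. Qed.

Lemma dotBr u v w : dot u (v - w) = dot u v - dot u w.
Proof. by rewrite dotDr dotNr. Qed.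

Lemma dotBl u v w : dot (u - v) w = dot u w - dot v w.
Proof. by rewrite dotDl dotNl. Qed.

Lemma dot0l v : dot 0 v = 0.
Proof. by rewrite -(scale0r 0) dotZl mul0r. Qed.

Lemma dot0r v : dot v 0 = 0.
Proof. by rewrite dotC dot0l. Qed.

Lemma dotrr_eq0 u : dot u u = 0 -> u = 0.
Proof.
move=> /eqP; rewrite psumr_eq0 => [/allP u0|i _]; last exact: sqr_ge0.
apply/rowP => i; have := u0 i (mem_index_enum i).
by rewrite mulf_eq0 orbb mxE => /eqP.
Qed.

Lemma dotrr_ge0 u : 0 <= dot u u.
Proof. by apply: sumr_ge0 => i _; exact: sqr_ge0. Qed.

Definition dotr v u : R := dot u v.

Lemma dotr_is_scalar v : scalar (dotr v).
Proof. by move=> a u w; rewrite /dotr dotDl dotZl. Qed.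

HB.instance Definition _ v :=
  GRing.isLinear.Build R 'rV[R]_m R *%R (dotr v) (dotr_is_scalar v).

(** The Riesz representation, in coordinates. *)
Lemma scalar_dotE (f : 'rV[R]_m -> R) :
  scalar f -> exists u, forall v, f v = dot v u.
Proof.
move=> f_scalar; pose L := GRing.isLinear.Build R 'rV[R]_m R *%R f f_scalar.
pose g : {scalar 'rV[R]_m} := HB.pack f L.
exists (\row_i f (delta_mx 0 i)) => v; rewrite -[f]/(g : _ -> _).
rewrite [v in LHS]row_sum_delta linear_sum; apply: eq_bigr => i _.
by rewrite scalarZ mxE.
Qed.

End Dot.

Lemma dot_row_mx (R : realType) m k (x u : 'rV[R]_m) (y v : 'rV[R]_k) :
  dot (row_mx x y) (row_mx u v) = dot x u + dot y v.
Proof.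
rewrite /dot big_split_ord /=; congr (_ + _); apply: eq_bigr => i _.
  by rewrite !row_mxEl.
by rewrite !row_mxEr.
Qed.

(** * Proper separation of a convex set from the origin *)

(** Induction on the dimension, by slicing D with the hyperplane H of vectors
    with zero first coordinate. If the first coordinate has constant weak sign
    on D and is not identically zero there, it (or its opposite) separates. If D
    lies in H, induction applies directly. Otherwise D meets both open
    half-spaces, hence its slice is nonempty, and the form v that induction
    gives on the slice is extended as in M. Riesz's extension theorem: a
    coefficient alpha for the first coordinate is suitable when
    - v(y) / s <= alpha for all (s, y) in D with s > 0 and
    alpha <= - v(y) / s for all (s, y) in D with s < 0; such an alpha exists as
    the segment joining two such points crosses H at a point of D. The extension
    is proper because v already is on the slice. *)
Lemma proper_separation_rV (R : realType) m (D : set 'rV[R]_m) :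
  convex_set D -> D !=set0 -> ~ D 0 ->
  exists u, (forall d, D d -> 0 <= dot d u) /\ (exists2 d, D d & 0 < dot d u).
Proof.
elim: m D => [|m IH] D.
  by move=> _ [d Dd] D0; exfalso; apply: D0; rewrite -(thinmx0 d).
pose cns (s : R) y : 'rV[R]_(1 + m) := row_mx s%:M y.
have cnsE (d : 'rV[R]_(1 + m)) : exists s y, d = cns s y.
  by exists (lsubmx d 0 0), (rsubmx d); rewrite /cns -mx11_scalar hsubmxK.
have dotcns s y a v : dot (cns s y) (cns a v) = s * a + dot y v.
  by rewrite dot_row_mx /dot big_ord1 !mxE eqxx.
have cnsconv t s y s' y' : t *: cns s y + (1 - t) *: cns s' y' =
    cns (t * s + (1 - t) * s') (t *: y + (1 - t) *: y').
  rewrite /cns !scale_row_mx add_row_mx; congr row_mx.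
  by rewrite !scale_scalar_mx -raddfD.
move=> /convex_setP cD [d0 Dd0] D0.
pose H : set 'rV[R]_m := [set y | D (cns 0 y)].
have cH : convex_set H.
  apply/convex_setP => y y' t t0 t1 Hy Hy'.
  by have := cD _ _ t t0 t1 Hy Hy'; rewrite cnsconv !mulr0 addr0.
have H0 : ~ H 0.
  by rewrite /H /= /cns raddf0 row_mx0.
have [[s1 [y1 [Dp s1p]]]|npos] :=
    pselect (exists s y, D (cns s y) /\ 0 < s); last first.
  have [[s2 [y2 [Dn s2n]]]|nneg] :=
      pselect (exists s y, D (cns s y) /\ s < 0).
    exists (cns (-1) 0); split; last first.
      by exists (cns s2 y2) => //; rewrite dotcns dot0r addr0 mulrN1 oppr_gt0.
    move=> d; have [s [y ->]] := cnsE d => Dd.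
    rewrite dotcns dot0r addr0 mulrN1 oppr_ge0 leNgt; apply/negP => s0.
    by apply: npos; exists s, y.
  have Dz s y : D (cns s y) -> s = 0.
    move=> Ds; apply/eqP; case: ltgtP => // s0; exfalso.
      by apply: nneg; exists s, y.
    by apply: npos; exists s, y.
  have [|v [v0 [y Hy vy]]] := IH H cH _ H0.
    move: Dd0; have [s [y ->]] := cnsE d0 => Dd0.
    by exists y; rewrite /H /= -(Dz _ _ Dd0).
  exists (cns 0 v); split; last first.
    by exists (cns 0 y) => //; rewrite dotcns mul0r add0r.
  move=> d; have [s [z ->]] := cnsE d => Dd; rewrite dotcns mulr0 add0r.
  by apply: v0; rewrite /H /= -(Dz _ _ Dd).
have [[s2 [y2 [Dn s2n]]]|nneg] :=
    pselect (exists s y, D (cns s y) /\ s < 0); last first.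
  exists (cns 1 0); split; last first.
    by exists (cns s1 y1) => //; rewrite dotcns dot0r addr0 mulr1.
  move=> d; have [s [y ->]] := cnsE d => Dd.
  rewrite dotcns dot0r addr0 mulr1 leNgt; apply/negP => s0.
  by apply: nneg; exists s, y.
(* The point of H on a segment joining the two sides. *)
have mix s y s' y' : D (cns s y) -> 0 < s -> D (cns s' y') -> s' < 0 ->
    H ((- s' / (s - s')) *: y + (1 - - s' / (s - s')) *: y').
  move=> Ds s0 Ds' s'0; have ss' : 0 < s - s' by lra.
  have t0 : 0 <= - s' / (s - s') by apply: divr_ge0; lra.
  have t1 : - s' / (s - s') <= 1 by rewrite ler_pdivrMr//; lra.
  have := cD _ _ _ t0 t1 Ds Ds'; rewrite cnsconv.
  suff -> : - s' / (s - s') * s + (1 - - s' / (s - s')) * s' = 0 by [].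
  by field; apply: lt0r_neq0.
have [|v [v0 [y Hy vy]]] := IH H cH _ H0; first by
  eexists; exact: mix Dp s1p Dn s2n.
have lohi s y0 s' y' : D (cns s y0) -> 0 < s -> D (cns s' y') -> s' < 0 ->
    - dot y0 v / s <= - dot y' v / s'.
  move=> Ds s0 Ds' s'0; have ss' : 0 < s - s' by lra.
  have := v0 _ (mix _ _ _ _ Ds s0 Ds' s'0); rewrite dotDl !dotZl.
  have -> : 1 - - s' / (s - s') = s / (s - s') by field; apply: lt0r_neq0.
  rewrite mulrAC [X in _ + X]mulrAC -mulrDl pmulr_lge0 ?invr_gt0// => h.
  rewrite -subr_ge0.
  have -> : - dot y' v / s' - - dot y0 v / s =
      (- s' * dot y0 v + s * dot y' v) / (s * - s').
    by field; rewrite ?(gt_eqF s0) ?(lt_eqF s'0).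
  by apply: divr_ge0 => //; apply: mulr_ge0; lra.
pose L : set R :=
  [set r | exists s y, [/\ D (cns s y), 0 < s & r = - dot y v / s]].
have Lub s' y' : D (cns s' y') -> s' < 0 -> ubound L (- dot y' v / s').
  by move=> Ds' s'0 _ [s [y0 [Ds s0 ->]]]; exact: lohi Ds s0 Ds' s'0.
have L0 : L !=set0 by exists (- dot y1 v / s1), s1, y1.
exists (cns (sup L) v); split; last first.
  by exists (cns 0 y) => //; rewrite dotcns mul0r add0r.
move=> d; have [s [z ->]] := cnsE d => Ds.
rewrite dotcns; have [s0|s0|s0] := ltgtP s 0.
- have : sup L <= - dot z v / s by apply: ge_sup => //; exact: Lub.
  by rewrite ler_ndivlMr// => h; lra.
- have : - dot z v / s <= sup L.
    by apply: ub_le_sup; [exists (- dot y2 v / s2); exact: Lub|exists s, z].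
  by rewrite ler_pdivrMr// => h; lra.
- by rewrite s0 mul0r add0r; apply: v0; rewrite /H /= -s0.
Qed.

Lemma proper_separation (R : realType) (V : vectType R) (D : set V) :
  convex_set D -> D !=set0 -> ~ D 0 ->
  exists u : {scalar V},
    (forall d, D d -> 0 <= u d) /\ (exists2 d, D d & 0 < u d).
Proof.
pose e := vbasis {:V}; have eP : basis_of {:V} e := vbasisP _.
move=> /convex_setP cD [d Dd] D0; pose D' := [set y | D (vecof e y)].
have [| | |u [u0 [y Dy uy]]] := @proper_separation_rV R _ D'.
- apply/convex_setP => x y t t0 t1.
  by rewrite /D' /= linearP linearZ; exact: cD.
- by exists (rVof e d); rewrite /D' /= rVofK.
- by rewrite /D' /= linear0.
exists (dotr u \o rVof e : {scalar V}); split => [v Dv|] /=.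
  by apply: u0; rewrite /D' /= rVofK.
by exists (vecof e y) => //=; rewrite vecofK.
Qed.

(** * The Fritz John multiplier rule *)

(** Properness of the separation survives as the second conclusion: when
    lambda = 0, the form u distinguishes some point of C from some point of the
    range of A. This is the nontriviality that a constraint qualification
    contradicts: u being nonzero would not do, because a nonzero form may be
    constant on a set C without interior. *)
Lemma fritz_john (R : realType) (W : lmodType R) (V : vectType R)
    (A : {linear W -> V}) (C : set V) (f : W -> R) (w0 : W) :
  convex_set C -> convex_function setT f ->
  C (A w0) -> (forall w, C (A w) -> f w0 <= f w) ->
  exists (u : {scalar V}) (lambda : R),
    [/\ lambda = 0 \/ lambda = 1,
        lambda = 0 -> exists w c, C c /\ u (A w) != u c,
        forall c, C c -> u (A w0) <= u c
      & forall w, lambda * f w0 - u (A w0) <= lambda * f w - u (A w)].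
Proof.
move=> /convex_setP cC /convex_functionP cf Cw0 minw0.
pose D : set (V * R^o) := [set p | exists w c r, [/\ C c, 0 < r
  & p = (c - A w, f w - f w0 + r)]].
have [| | |u [u0 [_ [w1 [c1 [r1 [Cc1 r10 ->]]]] ud]]] :=
  @proper_separation R _ D.
- apply/convex_setP => _ _ t t0 t1 [w [c [r [Cc r0 ->]]]]
    [w' [c' [r' [Cc' r'0 ->]]]].
  exists (t *: w + (1 - t) *: w'), (t *: c + (1 - t) *: c').
  exists (t * f w + (1 - t) * f w' - f (t *: w + (1 - t) *: w') +
          (t * r + (1 - t) * r')).
  split; first exact: cC.
    have := cf w w' t t0 t1; suff : 0 < t * r + (1 - t) * r' by lra.
    have [t00|t00] := ltP 0 t.
      by apply: ltr_pwDl; [exact: mulr_gt0|apply: mulr_ge0; lra].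
    have -> : t = 0 by lra.
    lra.
  apply: injective_projections => /=; last by rewrite /GRing.scale /=; ring.
  by rewrite linearP linearZ /= !scalerBr opprD addrACA.
- by exists (A w0 - A w0, f w0 - f w0 + 1), w0, (A w0), 1; split.
- move=> [w [c [r [Cc r0 [/eqP]]]]]; rewrite eq_sym subr_eq0 => /eqP cA.
  by have := minw0 w; rewrite -cA => /(_ Cc) fw0w /eqP; lra.

pose lam := u (0, 1).
have uE v (s : R) : u (v, s) = u (v, 0) + s * lam.
  have -> : (v, s) = (v, 0) + s *: (0, 1) :> V * R^o.
    apply: injective_projections => /=; first by rewrite scaler0 addr0.
    by rewrite add0r /GRing.scale /= mulr1.
  by rewrite linearD scalarZ.
have fst_scalar : scalar (fun v : V => u (v, 0)).
  move=> a v v'; rewrite -scalarP; congr (u _).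
  by apply: injective_projections => //=; rewrite scaler0 addr0.
have [u1 u1E] : exists u1 : {scalar V}, forall v, u1 v = u (v, 0).
  pose L := GRing.isLinear.Build R V R *%R (fun v : V => u (v, 0)) fst_scalar.
  by pose g : {scalar V} := HB.pack (fun v : V => u (v, 0)) L; exists g.
have {}u0 w c r : C c -> 0 < r -> 0 <= u1 c - u1 (A w) + (f w - f w0 + r) * lam.
  move=> Cc r0; rewrite -linearB u1E -uE; apply: u0.
  by exists w, c, r.
have {}ud : 0 < u1 c1 - u1 (A w1) + (f w1 - f w0 + r1) * lam.
  by rewrite -linearB u1E -uE.
have lam0 : 0 <= lam.
  by have := u0 w0 (A w0) 1 Cw0 ltr01; rewrite !subrr !add0r mul1r.
(* Let r tend to 0. *)
have {}u0 w c : C c -> 0 <= u1 c - u1 (A w) + (f w - f w0) * lam.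
  move=> Cc; apply/ler_addgt0Pr => e e0.
  have l1 : 0 < 1 + `|lam| by rewrite ltr_pwDl.
  have r0 : 0 < e / (1 + `|lam|) by apply: divr_gt0.
  have := u0 w c _ Cc r0; rewrite [X in X * lam]addrC mulrDl.
  suff : e / (1 + `|lam|) * lam <= e by lra.
  rewrite mulrAC ler_pdivrMr// ler_pM2l//.
  by have := ler_norm lam; lra.
have Au w c : C c -> lam = 0 -> u1 (A w) <= u1 c.
  by move=> Cc l0; have := u0 w c Cc; rewrite l0 mulr0 addr0 subr_ge0.
have [l0|lneq0] := eqVneq lam 0.
  exists u1, 0; split; [by left| |by move=> c Cc; exact: Au|].
    move=> _; exists w1, c1; split => //; rewrite lt_eqF//.
    by move: ud; rewrite l0; lra.
  move=> w; rewrite !mul0r !add0r lerN2; have := u0 w _ Cw0; rewrite l0; lra.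
have lgt0 : 0 < lam by rewrite lt0r lneq0.
have [u2 u2E] : exists u2 : {scalar V}, forall v, u2 v = lam^-1 * u1 v.
  by exists (lam^-1 \*: u1).
exists u2, 1; split; [by right|by move/eqP; rewrite oner_eq0| |].
  move=> c Cc; rewrite !u2E ler_pM2l ?invr_gt0//.
  by have := u0 w0 c Cc; lra.
move=> w; rewrite !u2E; have := u0 w _ Cw0; rewrite !mul1r => h.
have : 0 <= lam^-1 * (u1 (A w0) - u1 (A w) + (f w - f w0) * lam).
  by apply: mulr_ge0 => //; rewrite invr_ge0 ltW.
rewrite mulrDr mulrBr [_ * lam]mulrC mulKf//; lra.
Qed.

(** A subgradient at w0 is a multiplier for the minimisation of f over the
    single point w0, for which lambda = 0 is excluded: then u would be
    bounded above on the whole space, hence constant. *)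
Lemma subdifferential_neq0 (R : realType) m (f : 'rV[R]_m -> R) w0 :
  convex_function setT f -> subdifferential f w0 !=set0.
Proof.
move=> cf; pose C : set 'rV[R]_m := [set w0].
have cC : convex_set C.
  by apply/convex_setP => _ _ t _ _ -> ->; rewrite -scalerDl subrKC scale1r.
have [|w /= ->|u [l [l01 lu _ fu]]] // :=
  @fritz_john R 'rV[R]_m 'rV[R]_m idfun C f w0 cC cf.
have [g ug] := scalar_dotE (scalarP u); exists g => w.
have l1 : l = 1.
  case: l01 => // l0; have [w' [c [-> /eqP]]] := lu l0; case.
  have := fu w'; rewrite l0 /= !ug.
  (* Compare w' with its reflection in w0. *)
  have := fu (2 *: w0 - w'); rewrite l0 /= !ug dotBl dotZl; lra.
by have := fu w; rewrite l1 /= !mul1r !ug dotBl; lra.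
Qed.

(** * Dual cones and interior points *)

Lemma continuous_line (R : realType) m (a h : 'rV[R]_m) :
  a + l *: h @[l --> (0:R)] --> a.
Proof.
rewrite -[X in _ --> X]addr0 -[X in _ + X](scale0r h).
by apply: cvgD; [exact: cvg_cst|apply: cvgZr_tmp; exact: cvg_id].
Qed.

Lemma near_line (R : realType) m (a h : 'rV[R]_m) (P : set 'rV[R]_m) :
  nbhs a P -> exists2 l : R, 0 < l & P (a + l *: h).
Proof.
move=> /(continuous_line h) /= Pa.
have : \forall l \near 0^'+, P (a + l *: h).
  rewrite near_withinE; apply: (@filterS _ (nbhs (0 : R)) _ _ _ _ Pa).
  by move=> l Pl _.
move=> Pl; near (0:R)^'+ => l; exists l => //.
by near: l.
Unshelve. all: by end_near.
Qed.

Lemma dotr_continuous (R : realType) m (u : 'rV[R]_m) : continuous (dotr u).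
Proof.
apply: continuous_big => [|i _ v]; first exact: add_continuous.
by apply: (@cvgM _ _ (nbhs v)); [exact: coord_continuous|exact: cvg_cst].
Qed.

(** For a convex set every w - w0 with w in A is a tangent direction, with zero
    remainder; conversely the remainder of a tangent direction disappears in the
    limit. *)
Lemma dual_coneP (R : realType) m (A : set 'rV[R]_m) w0 u :
  convex_set A -> A w0 ->
  dual_cone A w0 u <-> forall w, A w -> 0 <= dot (w - w0) u.
Proof.
move=> /convex_setP cA Aw0; split=> [du w Aw|du w [eta [Aeta eta0]]].
  apply: du; exists (fun=> 0); split; last first.
    by under eq_fun do rewrite scaler0; exact: cvg_cst.
  near=> l; rewrite addr0.
  have -> : w0 + l *: (w - w0) = l *: w + (1 - l) *: w0.
    by rewrite scalerBr scalerBl scale1r addrCA addrA.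
  by apply: cA => //; near: l; exact: nbhs_right_le.
have lim : dot (w + l^-1 *: eta l) u @[l --> 0^'+] --> dot w u.
  rewrite -[X in _ --> dot X u]addr0.
  apply: (@continuous_cvg _ _ _ (0^'+) _ (fun l => w + l^-1 *: eta l) (dotr u)).
    exact: dotr_continuous.
  by apply: cvgD => //; exact: cvg_cst.
apply: (cvgr_to_ge lim); near=> l.
have l0 : 0 < l by [].
have Al : A (w0 + l *: w + eta l) by near: l.
rewrite -(pmulr_rge0 _ l0) -dotZl scalerDr scalerA divff ?gt_eqF// scale1r.
by have := du _ Al; rewrite addrC -!addrA addKr.
Unshelve. all: by end_near.
Qed.

(** A linear form that is minimal on A at a relatively interior point a is
    constant on A: from a one can move slightly within A away from any c. *)
Lemma orthogonal_of_relative_interior (R : realType) m (A : set 'rV[R]_m) a u :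
  relative_interior A a -> (forall c, A c -> 0 <= dot (c - a) u) ->
  forall c, A c -> dot (c - a) u = 0.
Proof.
move=> [Aa near_a] u_ge0 c Ac.
have [l l0 Al] := near_line (a - c) near_a.
(* The point is the affine combination (1 + l) a - l c. *)
have {}Al : A (a + l *: (a - c)).
  apply: Al; exists 2%N, (fun i => if i == 0 then a else c).
  exists (fun i => if i == 0 then 1 + l else - l); split.
  - by move=> i; case: ifP.
  - by rewrite big_ord_recl big_ord1 /=; ring.
  - rewrite big_ord_recl big_ord1 /= scalerBr scalerDl scale1r scaleNr.
    by rewrite addrA.
have := u_ge0 _ Al; rewrite addrAC subrr add0r dotZl pmulr_rge0//.
by rewrite -opprB dotNl; have := u_ge0 c Ac; lra.
Qed.

Lemma eq0_of_interior (R : realType) m (A : set 'rV[R]_m) a u :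
  A° a -> (forall c, A c -> 0 <= dot (c - a) u) -> u = 0.
Proof.
move=> /(near_line (- u)) [l l0 Al] u_ge0; apply: dotrr_eq0.
have := u_ge0 _ Al; rewrite addrAC subrr add0r dotZl pmulr_rge0// dotNl.
by have := dotrr_ge0 u; lra.
Qed.

(** * The constraints as one convex set in a product space *)

Lemma dot_vec2 (R : realType) n (x y u v : 'rV[R]_n) :
  dot (vec2 x y) (vec2 u v) = dot x u + dot y v.
Proof. exact: dot_row_mx. Qed.

Lemma dot_vec3 (R : realType) n (x y z u v w : 'rV[R]_n) :
  dot (vec3 x y z) (vec3 u v w) = dot x u + dot y v + dot z w.
Proof. by rewrite !dot_row_mx. Qed.

Lemma gph_vec3 (R : realType) n (G : 'rV[R]_n -> 'rV[R]_n -> set 'rV[R]_n)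
    x y z : gph G (vec3 x y z) <-> G x y z.
Proof.
split=> [[x' [y' [z' [Gz]]]]|Gz]; last by exists x, y, z.
by move=> /eq_row_mx [/eq_row_mx [-> ->] ->].
Qed.

Notation constraint_space R n M :=
  ({ffun 'I_M -> 'rV[R]_(n + n + n)} * ('rV[R]_n * 'rV[R]_n))%type.

Section Constraints.
Context {R : realType} {n M : nat}.
Local Notation V := (constraint_space R n M).
Implicit Types (v : V) (F : nat -> 'rV[R]_n -> 'rV[R]_n -> set 'rV[R]_n)
  (w x xs mus : nat -> 'rV[R]_n).

(** The linear map through which all constraints of the problem with horizon
    M.+1 act on a trajectory. *)
Definition windows w : V :=
  ([ffun t : 'I_M => vec3 (w t) (w t.+1) (w t.+2)], (w 0%N, w 1%N)).

Lemma windows_is_linear : linear windows.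
Proof.
move=> a w w'; apply: injective_projections => //=; apply/ffunP => t.
by rewrite !ffunE /vec3 !scale_row_mx !add_row_mx.
Qed.

HB.instance Definition _ :=
  GRing.isLinear.Build R (nat -> 'rV[R]_n) V *:%R windows
    windows_is_linear.

Definition constraint_set F (Q0 Q1 : set 'rV[R]_n) : set V :=
  [set v : V | [/\ forall t : 'I_M, gph (F t) (v.1 t), Q0 v.2.1 & Q1 v.2.2]].

Lemma feasible_windows F (Q0 Q1 : set 'rV[R]_n) w :
  feasible M.+1 F Q0 Q1 w <-> constraint_set F Q0 Q1 (windows w).
Proof.
split=> -[Fw Q0w Q1w]; split => // t.
  by rewrite ffunE; apply/gph_vec3; apply: Fw; exact: ltn_ord.
by move=> tM; have := Fw (Ordinal (tM : (t < M)%N)); rewrite ffunE => /gph_vec3.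
Qed.

Lemma convex_constraint_set F (Q0 Q1 : set 'rV[R]_n) :
  (forall t, (t < M)%N -> convex_set (gph (F t))) ->
  convex_set Q0 -> convex_set Q1 -> convex_set (constraint_set F Q0 Q1).
Proof.
move=> cF /convex_setP cQ0 /convex_setP cQ1; apply/convex_setP.
move=> v v' t t0 t1 [Fv Q0v Q1v] [Fv' Q0v' Q1v']; split.
- move=> s; have /convex_setP cFs := cF s (ltn_ord s).
  by rewrite /= !ffunE; exact: cFs.
- exact: cQ0.
- exact: cQ1.
Qed.

Definition pairing (U : nat -> 'rV[R]_(n + n + n)) (q0 q1 : 'rV[R]_n) v : R :=
  \sum_(t < M) dot (v.1 t) (U t) + dot v.2.1 q0 + dot v.2.2 q1.

Lemma pairingB U (q0 q1 : 'rV[R]_n) v v' :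
  pairing U q0 q1 v - pairing U q0 q1 v' =
  \sum_(t < M) dot (v.1 t - v'.1 t) (U t) +
  dot (v.2.1 - v'.2.1) q0 + dot (v.2.2 - v'.2.2) q1.
Proof.
under eq_bigr do rewrite dotBl.
by rewrite sumrB !dotBl /pairing; ring.
Qed.

(** Every linear form on the product space has this shape: restrict it to each
    factor. *)
Lemma pairing_repr (f : {scalar V}) :
  exists U q0 q1, forall v : V, f v = pairing U q0 q1 v.
Proof.
pose single t p : V :=
  ([ffun s : 'I_M => if s == t then p else 0], (0, 0)).
have U_ex t : exists u, forall p, f (single t p) = dot p u.
  apply: scalar_dotE => a p q; rewrite -scalarP; congr (f _).
  apply: injective_projections; last by rewrite /= !scaler0 !addr0.
  by apply/ffunP => s; rewrite !ffunE; case: ifP; rewrite // scaler0 addr0.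
have [U fU] := choice U_ex.
have [q0 fq0] : exists u, forall p, f (0, (p, 0)) = dot p u.
  apply: scalar_dotE => a p q; rewrite -scalarP; congr (f _).
  by do ?[apply: injective_projections => /=]; rewrite ?scaler0 ?addr0.
have [q1 fq1] : exists u, forall p, f (0, (0, p)) = dot p u.
  apply: scalar_dotE => a p q; rewrite -scalarP; congr (f _).
  by do ?[apply: injective_projections => /=]; rewrite ?scaler0 ?addr0.
exists (fun t => if insub t is Some i then U i else 0), q0, q1 => v.
have vE : v = \sum_(t < M) single t (v.1 t) +
    (0, (v.2.1, 0)) + (0, (0, v.2.2)).
  apply: injective_projections => /=; last first.
    rewrite (big_morph (@snd _ _) (fun _ _ => erefl) erefl) big1// add0r.
    by apply: injective_projections => /=; rewrite ?add0r ?addr0.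
  rewrite (big_morph (@fst _ _) (fun _ _ => erefl) erefl) !addr0.
  apply/ffunP => s; rewrite sum_ffunE (bigD1 s)//= ffunE eqxx big1 ?addr0//.
  by move=> t ts; rewrite ffunE eq_sym (negPf ts).
rewrite {1}vE !linearD fq0 fq1 linear_sum /pairing; congr (_ + _ + _).
by apply: eq_bigr => t _; rewrite fU valK.
Qed.

(** C is a product, so a form is minimal on it at v0 as soon as it cannot be
    decreased by changing a single component of v0. *)
Lemma pairing_minP F (Q0 Q1 : set 'rV[R]_n) U q0 q1 v0 :
  constraint_set F Q0 Q1 v0 ->
  (forall v, constraint_set F Q0 Q1 v ->
     pairing U q0 q1 v0 <= pairing U q0 q1 v) <->
  [/\ forall (t : 'I_M) p, gph (F t) p -> 0 <= dot (p - v0.1 t) (U t),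
      forall p, Q0 p -> 0 <= dot (p - v0.2.1) q0
    & forall p, Q1 p -> 0 <= dot (p - v0.2.2) q1].
Proof.
move=> [Fv0 Q0v0 Q1v0]; split; last first.
  move=> [U_ge0 q0_ge0 q1_ge0] v [Fv Q0v Q1v]; rewrite -subr_ge0 pairingB.
  rewrite !addr_ge0 ?q0_ge0 ?q1_ge0 ?sumr_ge0// => t _; exact: U_ge0.
move=> min_v0; split.
- move=> t p Fp; pose g := [ffun s => if s == t then p else v0.1 s].
  have := min_v0 (g, v0.2); rewrite -subr_ge0 pairingB /= !subrr !dot0l !addr0.
  rewrite (bigD1 t)//= ffunE eqxx big1 ?addr0 => [|s /negPf st]; last first.
    by rewrite ffunE st subrr dot0l.
  by apply; split => //= s; rewrite ffunE; case: eqP => // ->.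
- move=> p Qp; have := min_v0 (v0.1, (p, v0.2.2)).
  rewrite -subr_ge0 pairingB /= subrr dot0l addr0 big1 ?add0r => [|t _].
    by apply; split.
  by rewrite subrr dot0l.
- move=> p Qp; have := min_v0 (v0.1, (v0.2.1, p)).
  rewrite -subr_ge0 pairingB /= subrr dot0l addr0 big1 ?add0r => [|t _].
    by apply; split.
  by rewrite subrr dot0l.
Qed.

(** * The adjoint system *)

(** The sum of the dual vectors of conditions (i) and (ii), paired with v. *)
Definition adjoint_pairing xs mus : V -> R :=
  pairing (fun t => vec3 (xs t - mus t) (mus t.+1) (- xs t.+2))
    (mus 0%N - xs 0%N) (- xs 1%N).

(** Summation by parts: collecting the terms that contain the same state w_t,
    those in mu*_t and x*_t come from the windows starting at t - 1 and t - 2,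
    or from the initial constraints when t <= 1. The blocks a_t are left free
    here so that the identity can determine them in [adjoint_representation]. *)
Lemma pairing_windows (a xs mus w : nat -> 'rV[R]_n) :
  pairing (fun t => vec3 (a t) (mus t.+1) (- xs t.+2))
    (mus 0%N - xs 0%N) (- xs 1%N) (windows w) =
  \sum_(t < M) dot (w t) (a t - (xs t - mus t)) +
  dot (vec2 (w M) (w M.+1)) (vec2 (mus M - xs M) (- xs M.+1)).
Proof.
rewrite /pairing /=; under eq_bigr do rewrite ffunE dot_vec3.
rewrite dot_vec2; elim: M => [|k IH]; first by rewrite !big_ord0 !add0r.
rewrite !big_ord_recr /=; move: IH; rewrite !dotBr !dotNr; lra.
Qed.

Lemma adjoint_pairing_windows xs mus w :
  adjoint_pairing xs mus (windows w) =
  dot (vec2 (w M) (w M.+1)) (vec2 (mus M - xs M) (- xs M.+1)).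
Proof.
rewrite /adjoint_pairing (pairing_windows (fun t => xs t - mus t)).
by rewrite big1 ?add0r// => t _; rewrite subrr dot0r.
Qed.

(** The second and third blocks of the form, together with its components on
    Q_0 and Q_1, define mu* and x*. By [pairing_windows] the vanishing of the
    form on trajectories supported at one time t < M forces the first block to
    be x*_t - mu*_t. *)
Lemma adjoint_representation (f : {scalar V}) :
  (forall w, w M = 0 -> w M.+1 = 0 -> f (windows w) = 0) ->
  exists xs mus, forall v : V, f v = adjoint_pairing xs mus v.
Proof.
move=> f0; have [U [q0 [q1 fE]]] := pairing_repr f.
pose a t := lsubmx (lsubmx (U t)).
(* Only the difference mu*_0 - x*_0 matters, so mu*_0 may be zero. *)
pose mus t := if t is s.+1 then rsubmx (lsubmx (U s)) else 0.
pose xs t := match t with 0 => - q0 | 1 => - q1 | s.+2 => - rsubmx (U s) end.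
have UE t : U t = vec3 (a t) (mus t.+1) (- xs t.+2).
  by rewrite /vec3 /xs /mus /= opprK !hsubmxK.
have {}fE v : f v = pairing (fun t => vec3 (a t) (mus t.+1) (- xs t.+2))
    (mus 0%N - xs 0%N) (- xs 1%N) v.
  rewrite fE /pairing /= add0r !opprK; congr (_ + _ + _).
  by apply: eq_bigr => t _; congr dot; exact: UE.
exists xs, mus => v; rewrite fE /adjoint_pairing /pairing.
congr (_ + _ + _); apply: eq_bigr => t _; congr (dot _ (vec3 _ _ _)).
apply/subr0_eq/dotrr_eq0.
pose r := a t - (xs t - mus t).
have tM s : (M <= s)%N -> (s == t :> nat) = false.
  by move=> Ms; rewrite gtn_eqF// (leq_trans _ Ms).
have := f0 (fun s => if s == t then r else 0).
rewrite fE pairing_windows !tM// => /(_ erefl erefl).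
rewrite dot_vec2 !dot0l !addr0 (bigD1 t)//= eqxx big1 ?addr0//.
by move=> s st; rewrite -[_ == _]/(s == t) (negPf st) dot0l.
Qed.

(** Conditions (i) and (ii) together are minimality of a single linear form on
    the constraint set. *)
Lemma optimality_conditionsP F (Q0 Q1 : set 'rV[R]_n) phi x xs mus lambda :
  (forall t, (t < M)%N -> convex_set (gph (F t))) ->
  convex_set Q0 -> convex_set Q1 -> feasible M.+1 F Q0 Q1 x ->
  optimality_conditions M.+1 F Q0 Q1 phi x xs mus lambda <->
  (forall v, constraint_set F Q0 Q1 v ->
     adjoint_pairing xs mus (windows x) <= adjoint_pairing xs mus v) /\
  [set lambda *: g | g in subdifferential phi (vec2 (x M) (x M.+1))]
    (vec2 (mus M - xs M) (- xs M.+1)).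
Proof.
move=> cF cQ0 cQ1 fx; have [Fx Q0x Q1x] := fx.
have := pairing_minP (fun t => vec3 (xs t - mus t) (mus t.+1) (- xs t.+2))
  (mus 0%N - xs 0%N) (- xs 1%N) ((feasible_windows F Q0 Q1 x).1 fx).
move=> min_iff; split=> [[F_ Q0_ Q1_ phi_]|[/min_iff [F_ Q0_ Q1_] phi_]];
  split => //.
- apply/min_iff; split=> [t p| |]; last 2 first.
  + exact/(dual_coneP _ cQ0 Q0x).
  + exact/(dual_coneP _ cQ1 Q1x).
  rewrite ffunE; move: p; apply/dual_coneP; last exact: F_ (ltn_ord t).
    exact: cF (ltn_ord t).
  by apply/gph_vec3; apply: Fx; exact: ltn_ord.
- move=> t tM; apply/dual_coneP; [exact: cF|exact/gph_vec3/Fx|].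
  by move=> p /(F_ (Ordinal (tM : (t < M)%N))); rewrite ffunE.
- exact/(dual_coneP _ cQ0 Q0x).
- exact/(dual_coneP _ cQ1 Q1x).
Qed.

(** * Nondegeneracy and multipliers *)

(** The constraint qualification excludes proper multipliers with lambda = 0:
    the form is minimal on C, with value 0, at the windows of the nondegeneracy
    trajectory. With relatively interior components it is therefore constant on
    each factor of C. With interior components it is zero on each factor but
    one, and on this last one because arbitrary vectors of a single factor are
    attained by windows of trajectories. *)
Lemma nondegenerate_pairing_eq0 F (Q0 Q1 : set 'rV[R]_n) phi U q0 q1 :
  nondegeneracy_condition M.+1 F Q0 Q1 phi ->
  (forall w, pairing U q0 q1 (windows w) = 0) ->
  (forall v, constraint_set F Q0 Q1 v -> 0 <= pairing U q0 q1 v) ->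
  forall v, constraint_set F Q0 Q1 v -> pairing U q0 q1 v = 0.
Proof.
move=> [w nd] AP0 AP_ge0.
have Cw : constraint_set F Q0 Q1 (windows w).
  case: nd => [[Fw Q0w Q1w _]|[/feasible_windows //]].
  split=> [t| |]; rewrite ?ffunE; [|by case: Q0w|by case: Q1w].
  by have [] := Fw t (ltn_ord t).
have /(pairing_minP _ _ _ Cw) [U_ge0 q0_ge0 q1_ge0] :
    forall v, constraint_set F Q0 Q1 v ->
      pairing U q0 q1 (windows w) <= pairing U q0 q1 v.
  by move=> v Cv; rewrite AP0; exact: AP_ge0.
have U0_of_int (t : 'I_M) : (gph (F t))° (vec3 (w t) (w t.+1) (w t.+2)) ->
    U t = 0.
  move=> /eq0_of_interior; apply => c Fc.
  by have := U_ge0 t c Fc; rewrite ffunE.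
have U_eq0 (t : 'I_M) : q0 = 0 -> q1 = 0 -> 
    (forall s : 'I_M, s != t -> U s = 0) -> U t = 0.
  move=> q00 q10 Us; apply: dotrr_eq0.
  (* A trajectory whose window at t is U t itself. *)
  pose z s := if s == t :> nat then lsubmx (lsubmx (U t)) else
    if s == t.+1 then rsubmx (lsubmx (U t)) else rsubmx (U t).
  rewrite -[RHS](AP0 z) /pairing q00 q10 !dot0r !addr0.
  rewrite (bigD1 t)//= big1 => [|s st]; last by rewrite Us// dot0r.
  rewrite ffunE /z !eqxx !gtn_eqF// addr0; congr dot.
  by rewrite /vec3 !hsubmxK.
move=> v Cv; case: nd => [[Fw Q0w Q1w _]|[_ nd _]].
  have [Fv Q0v Q1v] := Cv.
  rewrite -[LHS]subr0 -(AP0 w) pairingB big1 => [|t _].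
    rewrite (orthogonal_of_relative_interior Q0w)//.
    by rewrite (orthogonal_of_relative_interior Q1w)// !addr0.
  rewrite ffunE.
  apply: (orthogonal_of_relative_interior (Fw t (ltn_ord t))) => //.
  by move=> c Fc; have := U_ge0 t c Fc; rewrite ffunE.
suff [U0 q00 q10] : [/\ forall t : 'I_M, U t = 0, q0 = 0 & q1 = 0].
  rewrite /pairing q00 q10 !dot0r !addr0 big1// => t _.
  by rewrite U0 dot0r.
case: nd => [[[t0 Fw] Q0w Q1w]|[Fw Q1w]|[Fw Q0w]].
- have q00 : q0 = 0 by exact: eq0_of_interior Q0w q0_ge0.
  have q10 : q1 = 0 by exact: eq0_of_interior Q1w q1_ge0.
  split=> // t; have [tt0|/eqP tt0] := eqVneq (t : nat) t0; last first.
    by apply: U0_of_int; apply: Fw => //; exact: ltn_ord.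
  apply: U_eq0 => // s st; apply: U0_of_int; apply: Fw; first exact: ltn_ord.
  by move=> st0; move: st; rewrite -(inj_eq val_inj) /= st0 tt0 eqxx.
- have q10 : q1 = 0 by exact: eq0_of_interior Q1w q1_ge0.
  have U0 (t : 'I_M) : U t = 0 by apply: U0_of_int; apply: Fw; exact: ltn_ord.
  split=> //; apply: dotrr_eq0; rewrite -[RHS](AP0 (fun=> q0)) /pairing.
  by rewrite q10 dot0r addr0 big1 ?add0r// => t _; rewrite U0 dot0r.
- have q00 : q0 = 0 by exact: eq0_of_interior Q0w q0_ge0.
  have U0 (t : 'I_M) : U t = 0 by apply: U0_of_int; apply: Fw; exact: ltn_ord.
  split=> //; apply: dotrr_eq0; rewrite -[RHS](AP0 (fun=> q1)) /pairing.
  by rewrite q00 dot0r addr0 big1 ?add0r// => t _; rewrite U0 dot0r.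
Qed.

(** The optimality conditions without constraint qualification. The last
    conclusion keeps the properness of the multipliers, from which follow both
    that they are not all zero and, under nondegeneracy, that lambda = 1. *)
Lemma fritz_john_trajectory F (Q0 Q1 : set 'rV[R]_n) phi x :
  (forall t, (t < M)%N -> convex_set (gph (F t))) ->
  convex_set Q0 -> convex_set Q1 -> convex_function setT phi ->
  optimal M.+1 F Q0 Q1 phi x ->
  exists xs mus (lambda : R),
    [/\ lambda = 0 \/ lambda = 1,
        optimality_conditions M.+1 F Q0 Q1 phi x xs mus lambda
      & lambda = 0 -> exists2 v, constraint_set F Q0 Q1 v &
          adjoint_pairing xs mus v != 0].
Proof.
move=> cF cQ0 cQ1 cphi [fx minx].
pose f w := phi (vec2 (w M) (w M.+1)).
have cf : convex_function [set: nat -> 'rV[R]_n] f.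
  apply/convex_functionP => w w' t t0 t1.
  have /convex_functionP := cphi; rewrite /f => cphi'.
  have -> : vec2 ((t *: w + (1 - t) *: w') M) ((t *: w + (1 - t) *: w') M.+1) =
      t *: vec2 (w M) (w M.+1) + (1 - t) *: vec2 (w' M) (w' M.+1).
    by rewrite /vec2 !scale_row_mx add_row_mx.
  exact: cphi'.
have Cx := (feasible_windows F Q0 Q1 x).1 fx.
have [w /feasible_windows /minx //|u [l [l01 lu uC uf]]] :=
  fritz_john (A := windows) (convex_constraint_set cF cQ0 cQ1) cf Cx.
have [|xs [mus uE]] := @adjoint_representation u.
  move=> w wM wM1.
  have fE s : f (x + s *: w) = f x.
    by rewrite /f !fctE wM wM1 scaler0 !addr0.
  have := uf (x + (-1) *: w); have := uf (x + 1 *: w).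
  have uE s : u (windows (x + s *: w)) = u (windows x) + s * u (windows w).
    have -> : windows (x + s *: w) = windows x + s *: windows w.
      by rewrite addrC windows_is_linear addrC.
    by rewrite linearD scalarZ.
  by rewrite !fE !uE; lra.
exists xs, mus, l.
(* Test the minimality of lambda phi - u o A against x with its last two
   states replaced by p: the adjoint pairing sees nothing else. *)
have slope p : l * phi (vec2 (x M) (x M.+1)) +
    dot (p - vec2 (x M) (x M.+1)) (vec2 (mus M - xs M) (- xs M.+1)) <=
    l * phi p.
  rewrite -(hsubmxK p).
  pose w s := if s == M then lsubmx p else if s == M.+1 then rsubmx p else x s.
  have := uf w; rewrite !uE !adjoint_pairing_windows /f /w eqxx gtn_eqF// eqxx.
  by rewrite dotBl; rewrite -[row_mx _ _]/(vec2 _ _); lra.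
have end0 : l = 0 -> vec2 (mus M - xs M) (- xs M.+1) = 0.
  move=> l0; apply/dotrr_eq0/eqP; rewrite eq_le dotrr_ge0 andbT.
  have := slope (vec2 (x M) (x M.+1) + vec2 (mus M - xs M) (- xs M.+1)).
  by rewrite l0 !mul0r add0r addrC addKr.
split => //; last first.
  move=> l0; have [w [c [Cc uwc]]] := lu l0; exists c => //.
  apply: contraNneq uwc; rewrite !uE => ->.
  by rewrite adjoint_pairing_windows end0// dot0r.
apply/optimality_conditionsP => //; split.
  by move=> v Cv; rewrite -!uE; exact: uC.
case: l01 => l_eq; last first.
  exists (vec2 (mus M - xs M) (- xs M.+1)); last by rewrite l_eq scale1r.
  by move=> p; have := slope p; rewrite l_eq !mul1r.
have [g gphi] := subdifferential_neq0 (vec2 (x M) (x M.+1)) cphi.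
by exists g => //; rewrite l_eq scale0r end0.
Qed.

End Constraints.

Theorem theorem3p1 (R : realType) (n N : nat)
    (F : nat -> 'rV[R]_n -> 'rV[R]_n -> set 'rV[R]_n)
    (Q0 Q1 : set 'rV[R]_n) (phi : 'rV[R]_(n + n) -> R)
    (x : nat -> 'rV[R]_n)
    (N_ge2 : (2 <= N)%N)
    (F_convex : forall t, (t.+2 <= N)%N -> convex_set (gph (F t)))
    (Q0_neq0 : Q0 !=set0) (Q0_convex : convex_set Q0)
    (Q1_neq0 : Q1 !=set0) (Q1_convex : convex_set Q1)
    (phi_continuous : continuous phi)
    (phi_convex : convex_function setT phi) :
  (optimal N F Q0 Q1 phi x ->
     exists (xs mus : nat -> 'rV[R]_n) (lambda : R),
       [/\ lambda = 0 \/ lambda = 1,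
           ~ [/\ forall t, (t <= N)%N -> xs t = 0,
                 forall t, (t <= N.-1)%N -> mus t = 0
               & lambda = 0]
         & optimality_conditions N F Q0 Q1 phi x xs mus lambda]) /\
  (nondegeneracy_condition N F Q0 Q1 phi ->
     (optimal N F Q0 Q1 phi x ->
        exists xs mus : nat -> 'rV[R]_n,
          optimality_conditions N F Q0 Q1 phi x xs mus 1) /\
     (feasible N F Q0 Q1 x ->
        (exists xs mus : nat -> 'rV[R]_n,
          optimality_conditions N F Q0 Q1 phi x xs mus 1) ->
        optimal N F Q0 Q1 phi x)).
Proof.
case: N N_ge2 F_convex => // M M_gt0 F_convex.
split=> [x_opt|nondeg].
  have [xs [mus [lambda [l01 opt proper]]]] :=
    fritz_john_trajectory F_convex Q0_convex Q1_convex phi_convex x_opt.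
  exists xs, mus, lambda; split=> // -[xs0 mus0 /proper[v _ /eqP]]; apply.
  rewrite /adjoint_pairing /pairing xs0// mus0// xs0//.
  rewrite subr0 oppr0 !dot0r !addr0.
  rewrite big1// => t _; have tM := ltn_ord t.
  rewrite (xs0 t) ?(leqW (ltnW tM))// xs0// !mus0// ?(ltnW tM)//.
  by rewrite subr0 oppr0 /vec3 !row_mx0 dot0r.
split=> [x_opt|x_feas [xs [mus]]].
  have [xs [mus [lambda [[l0|l1] opt proper]]]] :=
    fritz_john_trajectory F_convex Q0_convex Q1_convex phi_convex x_opt;
    last first.
    by exists xs, mus; rewrite -l1.
  have [x_feas _] := x_opt.
  have [v Cv /eqP] := proper l0; case.
  have [min_x [g _ end_eq]] :=
    (optimality_conditionsP _ _ _ _ F_convex Q0_convex Q1_convex x_feas).1 opt.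
  have AP0 w : adjoint_pairing xs mus (windows w : constraint_space R n M) = 0.
    by rewrite adjoint_pairing_windows -end_eq l0 scale0r dot0r.
  apply: (nondegenerate_pairing_eq0 nondeg AP0) Cv => v' Cv'.
  by rewrite -(AP0 x); exact: min_x.
move=> /(optimality_conditionsP _ _ _ _ F_convex Q0_convex Q1_convex x_feas).
move=> [min_x [g g_sub]]; rewrite scale1r => gE; split=> // y.
move=> /feasible_windows /min_x; rewrite !adjoint_pairing_windows -gE => le_xy.
have := g_sub (vec2 (y M) (y M.+1)); rewrite dotBl /cost /=; lra.
Qed.
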